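(* Let $\mathbb{F}_q$ be a finite field, let $G$ be a proper subgroup of the multiplicative group $\mathbb{F}_q^*$, and let $\{a_1,\dots,a_s\}$ be a set of representatives of the cosets of $G$ in $\mathbb{F}_q^*$, so that $\mathbb{F}_q^*/G=\{\overline{a_1},\dots,\overline{a_s}\}$, where $\overline{a}=aG$. Let $\overline{H}=\{\overline{a_{i_1}},\dots,\overline{a_{i_r}}\}$, $r\ge 1$, be a proper subgroup of $\mathbb{F}_q^*/G$ of order $r$. Let $1\le k<n$ and let $\alpha_1,\dots,\alpha_n$ be distinct elements of $\bigcup_{j=1}^{r}a_{i_j}G\cup\{0\}$; put $\bm\alpha=(\alpha_1,\dots,\alpha_n)$. If $\eta\in\mathbb{F}_q^*$ satisfies $(-1)^k\eta\in\mathbb{F}_q^*\setminus\bigcup_{j=1}^{r}a_{i_j}G$, then the twisted Reed-Solomon code $TRS_{k,n}[\bm\alpha,1,0,\eta]$ is an MDS code.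
   Context: For $\eta\in\mathbb{F}_q^*$ and distinct $\alpha_1,\dots,\alpha_n\in\mathbb{F}_q$, the twisted Reed-Solomon code with twist parameters $(t,h)=(1,0)$ is $$TRS_{k,n}[\bm\alpha,1,0,\eta]=\Big\{(f(\alpha_1),\dots,f(\alpha_n)) : f=\sum_{i=0}^{k-1}f_ix^i+\eta f_0x^{k},\ f_0,\dots,f_{k-1}\in\mathbb{F}_q\Big\}\subseteq\mathbb{F}_q^n.$$ A linear code of length $n$, dimension $k$ and minimum Hamming distance $d$ is MDS if $d=n-k+1$; here ''MDS'' means an MDS code of length $n$ and dimension $k$. *)

(* Defs.v *)
From HB Require Import structures.
From mathcomp Require Import all_boot all_order all_fingroup all_algebra.

Set Implicit Arguments.
Unset Strict Implicit.
Unset Printing Implicit Defensive.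

Import GRing.Theory.
Local Open Scope ring_scope.

Definition hamming_dist (F : finFieldType) (n : nat) (x y : 'rV[F]_n) : nat :=
  #|[set j : 'I_n | x 0 j != y 0 j]|.

(* A relation, so that codes with at most one word simply have no minimum
   distance. *)
Definition has_min_dist (F : finFieldType) (n : nat) (C : {set 'rV[F]_n})
    (d : nat) : Prop :=
  (exists x y : 'rV[F]_n,
     [/\ x \in C, y \in C, x != y & hamming_dist x y = d]) /\
  (forall x y : 'rV[F]_n,
     x \in C -> y \in C -> x != y -> (d <= hamming_dist x y)%N).

Definition linear_code (F : finFieldType) (n k d : nat) (C : {set 'rV[F]_n}) :
    Prop :=
  exists V : {vspace 'rV[F]_n},
    [/\ C =i V, \dim V = k & has_min_dist C d].

Definition MDS_code (F : finFieldType) (n k : nat) (C : {set 'rV[F]_n}) :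
    Prop :=
  linear_code k (n - k + 1)%N C.

(* [rVpoly f] is the polynomial f_0 + f_1 X + ... + f_(k-1) X^(k-1) whose
   coefficients are the entries of [f]; its constant coefficient is f_0
   provided 0 < k. *)
Definition twisted_poly (F : finFieldType) (k : nat) (eta : F) (f : 'rV[F]_k) :
    {poly F} :=
  rVpoly f + (eta * (rVpoly f)`_0) *: 'X^k.

(* Twist parameters (t, h) = (1, 0). *)
Definition TRS (F : finFieldType) (k n : nat) (alpha : 'I_n -> F) (eta : F) :
    {set 'rV[F]_n} :=
  [set \row_(j < n) (twisted_poly eta f).[alpha j] | f : 'rV[F]_k].

(* The union of the cosets (b j) G, as a set of elements of the field. *)
Definition union_cosets (F : finFieldType) (G : {group {unit F}}) (r : nat)
    (b : 'I_r -> {unit F}) : {set F} :=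
  [set FinRing.uval u | u in \bigcup_(j < r) (b j *: G)%g].

(* Main.v *)
(** A nonzero polynomial [f_0 + ... + f_(k-1) X^(k-1) + eta f_0 X^k] with [k]
    distinct roots [z_1, ..., z_k] has degree exactly [k], so comparing its
    constant and leading coefficients gives [(-1)^k eta (z_1 ... z_k) = 1].
    Hence the [z_j] are nonzero, and if they lie in a subgroup of [F^*] then so
    does [(-1)^k eta].  The union of the cosets in [Hbar] is the preimage of
    [Hbar] in [F^*], a subgroup avoiding [(-1)^k eta]; thus every nonzero
    codeword has fewer than [k] zeros, and the Singleton bound is attained. *)
Require Import Defs.
From HB Require Import structures.
From mathcomp Require Import all_boot all_order all_fingroup all_algebra.
From mathcomp Require Import cyclic zify ring.

Set Implicit Arguments.
Unset Strict Implicit.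
Unset Printing Implicit Defensive.

Import GRing.Theory.
Local Open Scope ring_scope.

(** The unit group of a finite field is cyclic, so every unit normalizes [G] and each coset is a
    fibre of [coset G]. This turns the union into a group, closed under products and inverses. *)
Lemma union_cosets_preim (F : finFieldType) (G : {group {unit F}}) (r : nat)
    (b : 'I_r -> {unit F}) (Hbar : {group coset_of G}) :
  Hbar :=: [set coset G (b j) | j : 'I_r] ->
  union_cosets G b = [set FinRing.uval u | u in (coset G @*^-1 Hbar)%g].
Proof.
move=> HbarE.
have nG (u : {unit F}) : u \in 'N(G)%g.
  have abF : abelian [set: {unit F}].
    exact: cyclic_abelian (field_unit_group_cyclic _).
  by apply: (subsetP (sub_abelian_norm abF (subsetT G))); rewrite inE.
rewrite /union_cosets.
suff -> : \bigcup_(j < r) (b j *: G)%g = (coset G @*^-1 Hbar)%g by [].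
apply/setP=> u; rewrite [RHS]inE nG inE HbarE.
apply/bigcupP/imsetP=> [[j _ uj] | [j _ uj]]; exists j => //.
  by apply/rcoset_kercosetP; rewrite ?nG // norm_rlcoset ?nG.
by rewrite -norm_rlcoset ?nG //; apply/rcoset_kercosetP; rewrite ?nG.
Qed.

Lemma coef_twisted_poly (F : finFieldType) (k : nat) (eta : F) (f : 'rV[F]_k)
    (l : nat) :
  (twisted_poly eta f)`_l = (rVpoly f)`_l + eta * (rVpoly f)`_0 * (l == k)%:R.
Proof. by rewrite coefD coefZ coefXn. Qed.

Lemma twisted_poly_is_linear (F : finFieldType) (k : nat) (eta : F) :
  linear (@twisted_poly F k eta).
Proof.
move=> c f g; rewrite /twisted_poly linearP coefD coefZ scalerDr scalerA.
rewrite addrACA -scalerDl; congr (_ + _ *: _).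
by rewrite mulrDr mulrCA.
Qed.

HB.instance Definition _ (F : finFieldType) (k : nat) (eta : F) :=
  GRing.isLinear.Build F 'rV[F]_k {poly F} *:%R (@twisted_poly F k eta)
    (@twisted_poly_is_linear F k eta).

Lemma twisted_poly_eq0 (F : finFieldType) (k : nat) (eta : F) (f : 'rV[F]_k) :
  (twisted_poly eta f == 0) = (f == 0).
Proof.
apply/eqP/eqP=> [p0 | ->]; last by rewrite linear0.
apply/rowP=> l; have := congr1 (fun p : {poly F} => p`_l) p0.
by rewrite /= coef_twisted_poly (ltn_eqF (ltn_ord l)) mulr0 addr0
   coef_rVpoly_ord coef0 mxE.
Qed.

(** The length [m] is left free: besides the encoder at all [n] points, evaluation at only [k.-1] of
    them is used to find a word of minimum weight. *)
Definition twisted_eval (F : finFieldType) (k m : nat) (alpha : 'I_m -> F)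
    (eta : F) (f : 'rV[F]_k) : 'rV[F]_m :=
  \row_j (twisted_poly eta f).[alpha j].

Lemma twisted_eval_is_linear (F : finFieldType) (k m : nat) (alpha : 'I_m -> F)
    (eta : F) : linear (@twisted_eval F k m alpha eta).
Proof. by move=> c f g; apply/rowP=> j; rewrite !mxE linearP !hornerE. Qed.

HB.instance Definition _ (F : finFieldType) (k m : nat) (alpha : 'I_m -> F)
    (eta : F) :=
  GRing.isLinear.Build F 'rV[F]_k 'rV[F]_m *:%R (@twisted_eval F k m alpha eta)
    (@twisted_eval_is_linear F k m alpha eta).

Lemma twisted_poly_roots (F : finFieldType) (k : nat) (eta : F) (f : 'rV[F]_k)
    (rs : seq F) :
    (0 < k)%N -> f != 0 -> uniq rs -> size rs = k ->
    all (root (twisted_poly eta f)) rs ->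
  (-1) ^+ k * eta * \prod_(z <- rs) z = 1.
Proof.
move=> k_gt0 f_neq0; set p := twisted_poly eta f => uniq_rs size_rs roots_rs.
have p_neq0 : p != 0 by rewrite twisted_poly_eq0.
(* The [k] distinct roots force degree at least [k]; the shape of [p] allows no more. *)
have size_p : size p = (size rs).+1.
  apply/eqP; rewrite eqn_leq max_poly_roots // andbT size_rs.
  rewrite (leq_trans (size_polyD _ _)) // geq_max.
  rewrite (leq_trans (size_poly _ _)) //=.
  by rewrite (leq_trans (size_scale_leq _ _)) // size_polyXn.
(* Since [0 < k], the twist leaves the constant coefficient untouched. *)
have lead_p : lead_coef p = eta * p`_0.
  rewrite lead_coefE size_p size_rs !coef_twisted_poly eqxx mulr1.
  by rewrite nth_default ?size_poly // add0r (ltn_eqF k_gt0) mulr0 addr0.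
(* Split [p] into linear factors over [rs] and evaluate at 0. *)
have p0 : p`_0 = eta * p`_0 * ((-1) ^+ k * \prod_(z <- rs) z).
  rewrite -[LHS]horner_coef0 [X in X.[0]](all_roots_prod_XsubC size_p) ?uniq_rootsE //.
  rewrite hornerZ lead_p horner_prod; congr (_ * _).
  under eq_bigr => z _ do rewrite hornerXsubC sub0r -mulN1r.
  by rewrite big_split /= big_const_seq count_predT size_rs iter_mulr_1.
have p0_neq0 : p`_0 != 0.
  by apply: contraNneq p_neq0 => p0_0; rewrite -lead_coef_eq0 lead_p p0_0 mulr0.
by apply: (mulfI p0_neq0); rewrite mulr1 [RHS]p0; ring.
Qed.

Lemma card_twisted_zeros (F : finFieldType) (H : {group {unit F}}) (k n : nat)
    (alpha : 'I_n -> F) (eta : F) (f : 'rV[F]_k) :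
    (0 < k)%N -> injective alpha ->
    (forall j, alpha j \in [set FinRing.uval u | u in H] :|: [set 0]) ->
    (-1) ^+ k * eta \notin [set FinRing.uval u | u in H] -> f != 0 ->
  (#|[set j | (twisted_poly eta f).[alpha j] == 0%R]| < k)%N.
Proof.
move=> k_gt0 alpha_inj alphaH etaH f_neq0; rewrite ltnNge.
set Z := [set j | _]; apply: contra etaH => le_k_Z.
(* The product identity needs exactly [k] roots, so surplus zeros are dropped. *)
pose rs := [seq alpha j | j <- take k (enum Z)].
have prod_rs : (-1) ^+ k * eta * \prod_(z <- rs) z = 1.
  apply: twisted_poly_roots f_neq0 _ _ _ => //.
  - by rewrite map_inj_uniq // take_uniq ?enum_uniq.
  - by rewrite size_map size_takel // -cardE.
  - apply/allP=> _ /mapP[j /mem_take + ->].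
    by rewrite mem_enum inE.
(* This rules out 0 as a root, so every chosen point lies in [H]. *)
have rs_neq0 : \prod_(z <- rs) z != 0.
  by apply: contra_eq_neq prod_rs => ->; rewrite mulr0 eq_sym oner_neq0.
have rsH : \prod_(z <- rs) z \in [set FinRing.uval u | u in H].
  rewrite big_seq; apply: (big_ind (fun x => x \in _)) => [|x y|z z_rs].
  - by apply/imsetP; exists 1%g; rewrite ?group1.
  - move=> /imsetP[u uH ->] /imsetP[v vH ->].
    by apply/imsetP; exists (u * v)%g; rewrite ?groupM.
  - have z_neq0 : z != 0.
      by move: rs_neq0; rewrite prodf_seq_neq0 => /allP/(_ z z_rs).
    have /mapP[j _ zE] := z_rs; move: z_neq0 (alphaH j).
    by rewrite zE !inE => /negPf->; rewrite orbF.
(* By [prod_rs], [(-1) ^+ k * eta] is the inverse of an element of [H]. *)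
have /imsetP[u uH uE] := rsH; apply/imsetP; exists u^-1%g; rewrite ?groupV //.
by apply: (mulIf rs_neq0); rewrite prod_rs FinRing.val_unitV -[\val u]uE mulVf.
Qed.

Lemma ker_neq0 (K : fieldType) (U V : vectType K) (g : {linear U -> V}) :
  (dim V < dim U)%N -> exists2 u, u != 0 & g u = 0.
Proof.
move=> ltVU; pose h := linfun g.
have ker_h : lker h != 0%VS.
  apply: contraTneq ltVU => h0; rewrite -leqNgt -!dimvf.
  by rewrite -(limg_dim_eq (f := h)) ?dimvS ?subvf // h0 capv0.
exists (vpick (lker h)); first by rewrite vpick0.
by have := memv_pick (lker h); rewrite memv_ker lfunE => /eqP.
Qed.

Theorem theorem3p2 (F : finFieldType) (G : {group {unit F}})
    (s : nat) (a : 'I_s -> {unit F})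
    (r : nat) (i : 'I_r -> 'I_s) (Hbar : {group coset_of G})
    (k n : nat) (alpha : 'I_n -> F) (eta : F)
    (properG : G \proper [set: {unit F}])
    (a_inj : injective (fun m : 'I_s => coset G (a m)))
    (a_repr : ([set: {unit F}] / G)%g = [set coset G (a m) | m : 'I_s])
    (r_gt0 : (1 <= r)%N)
    (HbarE : Hbar :=: [set coset G (a (i j)) | j : 'I_r])
    (properH : Hbar \proper ([set: {unit F}] / G)%g)
    (cardH : #|Hbar| = r)
    (kn : (1 <= k < n)%N)
    (alpha_inj : injective alpha)
    (alpha_in : forall j : 'I_n,
       alpha j \in union_cosets G (fun l => a (i l)) :|: [set 0])
    (eta_neq0 : eta != 0)
    (eta_notin : (-1) ^+ k * eta \in
       [set x : F | x != 0] :\: union_cosets G (fun l => a (i l))) :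
  MDS_code k (TRS k alpha eta).
Proof.
have [k_gt0 lt_kn] := andP kn.
pose phi : {linear 'rV[F]_k -> 'rV[F]_n} := @twisted_eval F k n alpha eta.
have UE := union_cosets_preim HbarE.
pose zeros f := #|[set j | phi f 0 j == 0]|.
have few_zeros (f : 'rV[F]_k) : f != 0 -> (zeros f < k)%N.
  move=> f_neq0; rewrite /zeros; under eq_finset => j do rewrite mxE.
  apply: (card_twisted_zeros (H := (coset G @*^-1 Hbar)%G)) => //.
    by move=> j; rewrite -UE.
  by move: eta_notin; rewrite inE UE => /andP[].
(* By linearity, two codewords agree exactly at the zeros of the codeword of [f - g]. *)
have distE (f g : 'rV[F]_k) :
    (hamming_dist (phi f) (phi g) + zeros (f - g)%R)%N = n.
  rewrite -[RHS]card_ord -(cardC [set j | phi f 0%R j != phi g 0%R j]).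
  congr (_ + _)%N; apply: eq_card => j.
  by rewrite !inE negbK linearB !mxE subr_eq0.
(* Distinct messages with equal codewords would give [n] zeros, yet fewer than [k < n] are
   possible. *)
have phi_inj : injective phi.
  move=> f g fg; apply/eqP; rewrite -subr_eq0; apply: contraTT lt_kn.
  move=> /few_zeros; have := distE f g; rewrite fg.
  have -> : hamming_dist (phi g) (phi g) = 0%N.
    by apply: eq_card0 => j; rewrite !inE eqxx.
  by rewrite add0n => ->; rewrite -leqNgt; apply: ltnW.
exists (limg (linfun phi)); split.
- move=> x; apply/imsetP/memv_imgP=> [[f _ ->]|[f _ ->]]; exists f => //.
    by rewrite memvf.
  by rewrite lfunE.
  by rewrite lfunE.
- rewrite limg_dim_eq; first by rewrite dimvf dim_matrix; apply: mul1n.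
  apply/eqP; rewrite -subv0; apply/subvP=> f.
  rewrite memv_cap memv_ker memv0 lfunE => /andP[_ /eqP f0].
  by apply/eqP/phi_inj; rewrite f0 linear0.
split; last first.
  move=> _ _ /imsetP[f _ ->] /imsetP[g _ ->] fg.
  have f_neq_g : f - g != 0 by rewrite subr_eq0; apply: contra_neq fg => ->.
  rewrite -[leqRHS](addnK (zeros (f - g))) distE.
  by have := few_zeros _ f_neq_g; move: (zeros _) => z; lia.
(* To attain the distance, impose zeros at the first [k.-1] points: these are fewer conditions than
   the [k] message coordinates, so some nonzero [f] meets them. By [few_zeros] it has no further
   zeros, and its codeword has weight [n - k + 1]. *)
have le_n : (k.-1 <= n)%N by lia.
pose psi : {linear 'rV[F]_k -> 'rV[F]_k.-1} :=
  @twisted_eval F k k.-1 (alpha \o widen_ord le_n) eta.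
have [|f f_neq0 psi_f] := @ker_neq0 F 'rV_k 'rV_k.-1 psi.
  by rewrite !dim_matrix; lia.
exists (phi f), (phi 0); split; try exact: imset_f.
  by rewrite (inj_eq phi_inj).
have ge_zeros : (k.-1 <= zeros f)%N.
  have widen_inj : injective (widen_ord le_n).
    by move=> j1 j2 /(congr1 val) /= /val_inj.
  rewrite -[leqLHS]card_ord -(card_imset _ widen_inj).
  apply/subset_leq_card/subsetP=> _ /imsetP[j _ ->].
  have := congr1 (fun v : 'rV_k.-1 => v 0 j) psi_f.
  by rewrite inE !mxE /= => ->.
have := few_zeros f f_neq0; have := distE f 0; rewrite subr0.
by move: (zeros f) (hamming_dist _ _) ge_zeros => z d; lia.
Qed.
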